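(* Suppose $\Gamma$ is a connected, locally finite graph, and that $G$ is a locally compact group admitting a proper quasitransitive action on $\Gamma$. Then $\Gamma$ is amenable if and only if $G$ is amenable and unimodular.
   Context: Groups. Let $\mu$ be a (left) Haar measure on a locally compact group $G$. The modular homomorphism $\Delta_G:G\to\mathbb{R}^*_+$ is defined by $\mu(Ag)=\Delta_G(g)\mu(A)$ for all Borel $A\subseteq G$ and $g\in G$; $G$ is unimodular if $\Delta_G\equiv 1$. $G$ is amenable if for every compact $K\subseteq G$ and every $\varepsilon>0$ there is a compact set $U\subseteq G$ of positive measure with $\mu(KU)/\mu(U)\le 1+\varepsilon$. Graphs. For a set $A$ of vertices of a graph $\Gamma$, $\partial A$ is the set of vertices not in $A$ that have a neighbour in $A$. The Cheeger constant is $\mathrm{h}(\Gamma)=\inf |\partial A|/|A|$ over finite non-empty sets $A$ of vertices, and $\Gamma$ is amenable if $\mathrm{h}(\Gamma)=0$. Actions. All actions of topological groups on graphs are by graph automorphisms and continuous, i.e. the induced homomorphism $G\to\mathrm{Aut}(\Gamma)$ is continuous for the topology of pointwise convergence on $\mathrm{Aut}(\Gamma)$. An action is proper if vertex stabilisers are compact in $G$, and quasitransitive if there are only finitely many orbits of vertices. *)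

(* Defs.v *)
From HB Require Import structures.
From mathcomp Require Import all_boot all_order all_algebra finmap.
From mathcomp Require Import all_classical all_reals all_analysis.

Set Implicit Arguments.
Unset Strict Implicit.
Unset Printing Implicit Defensive.

Import Order.TTheory GRing.Theory Num.Theory.

Local Open Scope classical_set_scope.
Local Open Scope ring_scope.

Record graph := Graph {
  vertex :> choiceType;
  adj : rel vertex;
  adj_sym : symmetric adj;
  adj_irr : irreflexive adj
}.

Section Graphs.
Context (Gam : graph).

(* As usual, the graph without vertices does not count as connected. *)
Definition connected_graph : Prop :=
  (exists v : Gam, True) /\
  forall u v : Gam, exists2 p : seq Gam, path (@adj Gam) u p & last u p = v.

Definition locally_finite : Prop :=
  forall u : Gam, finite_set [set v | adj u v].

Definition vboundary (A : set Gam) : set Gam :=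
  [set v | ~ A v /\ exists2 u, A u & adj u v].

(* [fset_set] is the finite set with the given elements when there are finitely
   many of them, and is empty otherwise; the boundary of a finite set of
   vertices is always finite in a locally finite graph. *)
Definition cheeger (R : realType) : R :=
  inf [set #|` fset_set (vboundary [set` A])|%:R / #|` A|%:R
      | A in [set A : {fset Gam} | A != fset0]].

Definition amenable_graph (R : realType) : Prop := cheeger R = 0.

End Graphs.

HB.mixin Record isTopologicalGroup (G : Type) of Group G & Topological G := {
  mulg_continuous : continuous (fun x : G * G => (x.1 * x.2)%g);
  invg_continuous : continuous (fun x : G => (x^-1)%g)
}.

(* The distinguished point plays no role in the mathematics; it is required
   by [g_sigma_algebraType]. *)
#[short(type="topologicalGroupType")]
HB.structure Definition TopologicalGroup :=
  {G of Group G & PointedTopological G & isTopologicalGroup G}.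

Notation borel G := (g_sigma_algebraType (@open G)).

Section HaarMeasure.
Context (R : realType) (G : topologicalGroupType).
Implicit Type mu : {measure set (borel G) -> \bar R}.

Definition ltranslate (g : G) (A : set G) : set G := [set (g * a)%g | a in A].
Definition rtranslate (A : set G) (g : G) : set G := [set (a * g)%g | a in A].
Definition mulset (A B : set G) : set G :=
  [set (a * b)%g | a in A & b in B].

Record left_haar_measure mu : Prop := LeftHaarMeasure {
  haar_neq0 : mu [set: G] <> 0%E;
  haar_invariant : forall (g : G) (A : set (borel G)), measurable A ->
    mu (ltranslate g A) = mu A;
  haar_compact : forall K : set G, compact K -> (mu K < +oo)%E;
  haar_outer_regular : forall A : set (borel G), measurable A ->
    mu A = ereal_inf [set mu U | U in [set U : set G | open U /\ A `<=` U]];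
  haar_inner_regular : forall U : set G, open U ->
    mu U = ereal_sup [set mu K | K in [set K : set G | compact K /\ K `<=` U]]
}.

Definition modular_hom mu (Delta : G -> R) : Prop :=
  (forall g, 0 < Delta g) /\
  forall (g : G) (A : set (borel G)), measurable A ->
    mu (rtranslate A g) = ((Delta g)%:E * mu A)%E.

Definition unimodular mu : Prop :=
  exists2 Delta : G -> R, modular_hom mu Delta & forall g, Delta g = 1.

Definition amenable_group mu : Prop :=
  forall K : set G, compact K -> forall eps : R, 0 < eps ->
  exists U : set G, [/\ compact U, (0 < mu U)%E &
    (mu (mulset K U) / mu U <= (1 + eps)%:E)%E].

End HaarMeasure.

Section Actions.
Context (G : topologicalGroupType) (Gam : graph).

(* Aut(Gam), with its topology of pointwise convergence, is a subspace of the
   product [{ptws Gam -> discrete_topology Gam}], so a map into Aut(Gam) is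
   continuous when it is so into the product. *)
Record graph_action (act : G -> Gam -> Gam) : Prop := GraphAction {
  act1 : forall v, act 1%g v = v;
  actM : forall g h v, act (g * h)%g v = act g (act h v);
  act_adj : forall g u v, adj (act g u) (act g v) = adj u v;
  act_continuous :
    continuous (act : G -> {ptws Gam -> discrete_topology Gam})
}.

Definition stabiliser (act : G -> Gam -> Gam) (v : Gam) : set G :=
  [set g | act g v = v].

Definition orbit (act : G -> Gam -> Gam) (v : Gam) : set Gam :=
  range (act^~ v).

Definition proper_action (act : G -> Gam -> Gam) : Prop :=
  forall v, compact (stabiliser act v).

Definition quasitransitive (act : G -> Gam -> Gam) : Prop :=
  finite_set (range (orbit act)).

End Actions.

(* Main.v *)
Require Import Defs.
From HB Require Import structures.
From mathcomp Require Import all_boot all_order all_algebra finmap.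
From mathcomp Require Import all_classical all_reals all_analysis.
From mathcomp Require Import measurable_realfun ring lra.

(** Fix a vertex [o], let [X] be its orbit and [H] its stabiliser, a compact
    open subgroup.  Both sides of the equivalence are compared with the
    existence, at every scale [r], of finite subsets [D] of [X] that grow
    little when they are thickened by [r] inside [X] (predicate [folner]).

    On the graph side, quasitransitivity and connectedness bound the sizes of
    balls of a given radius and make [X] dense at some scale; so one may trade
    a set of vertices of small boundary for its trace on [X] and conversely
    ([amenable_folner], [folner_amenable]).

    On the group side, a finite subset [D] of [X] gives two subsets of [G]:
    the [x] with [x o] in [D], a union of #|D| left cosets of [H], and the [x]
    with [x^-1 o] in [D], a union of #|D| right cosets of [H].  The first
    always has measure #|D| times that of [H].  The second has this measure
    as soon as [mu] is right invariant, and since left multiplication by [g]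
    moves the points [x^-1 o] inside their orbit by bounded distances when [g]
    ranges over a compact set, it turns [folner] into amenability of [G] and
    back ([folner_amenable_group], [amenable_group_folner]).

    It remains to deduce unimodularity from [folner].  If [v] lies in [X] at
    distance at most [r] from [o], then [x v] in [D] forces [x o] into the
    thickening of [D], and comparing the measures of the two sets of [x] gives
    mu(G_v) <= (1 + eps) mu(G_o) for all [eps].  By symmetry all stabilisers of
    points of [X] have the same measure; as they are conjugate, this says that
    mu(H g) = mu(H) for all [g].  Passing from [H] to all Borel sets is the
    uniqueness of Haar measure, applied to [mu] and its right translate.

    Uniqueness ([haar_unique]) has an elementary proof when there is a compact
    open subgroup [H].  Given a compact K inside an open U inside [H], take a
    neighbourhood V of 1 such that V^-1 V K lies in U and a list T of elements of [H], as short as possible,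
    such that the translates V t cover [H].  Minimality yields an exchange
    property ([minimal_covering_count]): for g, h in [H], at most as many t in
    T satisfy t g in K as satisfy t h in U.  Averaging over g for one measure
    and over h for the other compares the measure of K with that of U, and
    regularity does the rest. *)

Set Implicit Arguments.
Unset Strict Implicit.
Unset Printing Implicit Defensive.

Import Order.TTheory GRing.Theory Num.Theory.

Local Open Scope classical_set_scope.
Local Open Scope ring_scope.

(** * Distances, balls and boundaries *)

Section Distance.
Context (Gam : graph).
Implicit Types (u v w : Gam) (r s : nat) (A : set Gam).

(** [dist_le r u v] means that the graph distance from [u] to [v] is at most
    [r]; this avoids speaking of shortest paths. *)
Fixpoint dist_le r u v : Prop :=
  if r is r'.+1 then exists2 w, dist_le r' u w & w = v \/ adj w v else u = v.

Lemma dist_le_refl r u : dist_le r u u.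
Proof. by elim: r => //= r IH; exists u => //; left. Qed.

Lemma dist_le_trans r s u v w : dist_le r u v -> dist_le s v w -> dist_le (r + s) u w.
Proof.
move=> ruv; elim: s w => [w <-|s IH w [x svx xw]]; first by rewrite addn0.
by rewrite addnS; exists x => //; exact: IH.
Qed.

Lemma dist_le_sym r u v : dist_le r u v -> dist_le r v u.
Proof.
elim: r u v => [u v <-//|r IH u v [w ruw wv]].
rewrite -[r.+1]add1n; apply: (@dist_le_trans _ _ _ w); last exact: IH.
exists v => //; case: wv => [->|]; first by left.
by rewrite adj_sym; right.
Qed.

Lemma dist_leW r s u v : (r <= s)%N -> dist_le r u v -> dist_le s u v.
Proof.
by move=> /subnKC <- ruv; apply: dist_le_trans ruv _; exact: dist_le_refl.
Qed.

Lemma adj_dist_le u v : adj u v -> dist_le 1 u v.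
Proof. by exists u => //; right. Qed.

Lemma connected_dist_le : connected_graph Gam -> forall u v, exists r, dist_le r u v.
Proof.
move=> [_ conn] u v; have [p] := conn u v.
elim: p u => [u _ <-|w p IH u /= /andP[uw pw] lp]; first by exists 0%N.
have [r rwv] := IH _ pw lp; exists (1 + r)%N.
exact: dist_le_trans (adj_dist_le uw) rwv.
Qed.

Lemma finite_ball r u : locally_finite Gam -> finite_set [set v | dist_le r u v].
Proof.
move=> lf; elim: r => [|r IH].
  by apply: sub_finite_set (finite_set1 u) => v /= <-.
apply: (@sub_finite_set _ _
  (\bigcup_(w in [set w | dist_le r u w]) ([set w] `|` [set v | adj w v]))).
  by move=> v /= [w ruw wv]; exists w => //; case: wv => [->|]; [left|right].
by apply: bigcup_finite => // w _; rewrite finite_setU; split.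
Qed.

(** A walk leaving [A] has to step on the boundary when it first leaves. *)
Lemma dist_le_vboundary r A u v : A u -> ~ A v -> dist_le r u v ->
  exists2 b, vboundary A b & dist_le r b v.
Proof.
move=> Au; elim: r v => [v nAv /= uv|r IH v nAv [w ruw wv]]; first by subst v.
have [Aw|nAw] := pselect (A w).
  exists v; last exact: dist_le_refl.
  case: wv => [wv|wv]; first by subst w.
  by split => //; exists w.
by have [b Ab rbw] := IH _ nAw ruw; exists b => //; exists w.
Qed.

Lemma fset_thickening (X : set Gam) r (D : {fset Gam}) : locally_finite Gam ->
  exists D' : {fset Gam},
    forall x, x \in D' <-> X x /\ exists2 d, d \in D & dist_le r d x.
Proof.
move=> lf; set P := fun x => X x /\ exists2 d, d \in D & dist_le r d x.
have fP : finite_set P.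
  apply: (@sub_finite_set _ _ (\bigcup_(d in [set` D]) [set x | dist_le r d x])).
    by move=> x [_ [d dD dx]]; exists d.
  by apply: bigcup_finite => // d _; exact: finite_ball.
by exists (fset_set P) => x; rewrite in_fset_set// inE.
Qed.

Lemma finite_vboundary (A : {fset Gam}) : locally_finite Gam ->
  finite_set (vboundary [set` A]).
Proof.
move=> lf; apply: (@sub_finite_set _ _
  (\bigcup_(u in [set` A]) [set v | adj u v])).
  by move=> v [_ [u Au uv]]; exists u.
by apply: bigcup_finite => // u _; exact: lf.
Qed.

(** The balls of a given radius have bounded size; this is recorded through
    its consequence on coverings by balls, the way it serves to compare
    cardinals. *)
Definition bounded_balls := forall r, exists c : nat, forall X Y : {fset Gam},
  (forall x, x \in X -> exists2 y, y \in Y & dist_le r y x) ->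
  (#|` X| <= c * #|` Y|)%N.

Lemma card_covering r c : locally_finite Gam ->
  (forall u, #|` fset_set [set v | dist_le r u v]| <= c)%N ->
  forall X Y : {fset Gam},
  (forall x, x \in X -> exists2 y, y \in Y & dist_le r y x) ->
  (#|` X| <= c * #|` Y|)%N.
Proof.
move=> lf cP X Y XY.
pose s := flatten [seq enum_fset (fset_set [set v | dist_le r u v]) | u <- Y].
apply: (@leq_trans (size s)).
  apply: uniq_leq_size; first exact: fset_uniq.
  move=> x /XY[y yY ryx]; apply/flattenP.
  exists (enum_fset (fset_set [set v | dist_le r y v])); first exact: map_f.
  by rewrite in_fset_set ?inE//; exact: finite_ball.
rewrite {}/s.
elim: (enum_fset Y) => [|y t IH]; first by rewrite muln0.
by rewrite /= size_cat mulnS leq_add// cP.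
Qed.

(** * Amenability of the graph seen on a dense set of vertices *)

Section Folner.
Context (R : realType).

(** Small growth at every scale of finite subsets of [X].  Only the points of
    [X] count in the thickening: this is what measures of subsets of a group
    see when [X] is an orbit. *)
Definition folner (X : set Gam) := forall r (eps : R), 0 < eps ->
  exists D D' : {fset Gam}, [/\ D != fset0, [set` D] `<=` X,
    forall x, x \in D' <-> X x /\ exists2 d, d \in D & dist_le r d x &
    #|` D'|%:R <= (1 + eps) * #|` D|%:R].

Lemma amenable_graphP (v0 : Gam) : amenable_graph Gam R <->
  forall eps : R, 0 < eps -> exists2 A : {fset Gam}, A != fset0 &
    #|` fset_set (vboundary [set` A])|%:R <= eps * #|` A|%:R.
Proof.
rewrite /amenable_graph /cheeger; set S := [set _ | _ in _].
have S0 : S !=set0.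
  eexists; exists [fset v0]%fset => //=.
  by apply/fset0Pn; exists v0; rewrite in_fset1.
have lb0 : lbound S 0 by move=> _ [A _ <-]; exact: divr_ge0.
split=> [S_0 eps eps0|H].
  have hinf : has_inf S by split => //; exists 0.
  have [_ [A A0 <-]] := inf_adherent eps0 hinf.
  rewrite S_0 add0r => /ltW h; exists A => //.
  by rewrite -ler_pdivrMr// ltr0n cardfs_gt0.
apply/eqP; rewrite eq_le; apply/andP; split; last exact: lb_le_inf.
apply/ler_addgt0Pr => eps /H[A A0 hA]; rewrite add0r.
apply: (@le_trans _ _ (#|` fset_set (vboundary [set` A])|%:R / #|` A|%:R)).
  by apply: ge_inf; [exists 0|exists A].
by rewrite ler_pdivrMr// ltr0n cardfs_gt0.
Qed.

Variable v0 : Gam.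
Variables (X : set Gam) (R0 : nat).
Hypotheses (lf : locally_finite Gam) (bb : bounded_balls).
Hypothesis X_dense : forall v, exists2 x, X x & dist_le R0 x v.

(** [D] is the trace on [X] of the [R0]-thickening of a set [A] of small
    boundary.  The points of [X] near [D] but outside it are outside [A], so
    each is within [R0 + r] of the boundary of [A], whereas [A] is covered by
    the balls of radius [R0] around [D]. *)
Lemma amenable_folner : amenable_graph Gam R -> folner X.
Proof.
move=> /(amenable_graphP v0) am r eps eps0.
have [c1 c1P] := bb R0; have [c2 c2P] := bb (R0 + r).
(* The growth found below is [c1 * c2] times the boundary ratio of [A]; adding
   1 makes the divisor positive. *)
pose k : R := c2%:R * c1%:R + 1.
have k0 : 0 < k by rewrite ltr_wpDl// mulr_ge0.
have [A A0 hA] := am (eps / k) (divr_gt0 eps0 k0).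
have [D DP] := fset_thickening X R0 A lf.
have AD : (#|` A| <= c1 * #|` D|)%N.
  apply: c1P => a aA; have [x Xx xa] := X_dense a.
  by exists x => //; apply/DP; split => //; exists a => //; exact: dist_le_sym.
have [D' D'P] := fset_thickening X r D lf.
exists D, D'; split => //.
- apply: contra_neq A0 => D0; apply/eqP; rewrite -cardfs_eq0 -leqn0.
  by rewrite (leq_trans AD)// D0 cardfs0 muln0.
- by move=> x /DP[].
have DD' : (D `<=` D')%fset.
  apply/fsubsetP => d dD; apply/D'P; split; first by case/DP: dD.
  by exists d => //; exact: dist_le_refl.
have := cardfsDS DD'; set E := (D' `\` D)%fset => cE.
have EP e : e \in E ->
    [/\ X e, e \notin D & exists2 d, d \in D & dist_le r d e].
  by rewrite in_fsetD => /andP[eD /D'P[]].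
have EA : (#|` E| <= c2 * #|` fset_set (vboundary [set` A])|)%N.
  apply: c2P => e /EP[Xe eD [d /DP[_ [a aA ad]] de]].
  have nAe : ~ [set` A] e.
    move=> /= eA; move/negP: eD; apply; apply/DP; split => //.
    by exists e => //; exact: dist_le_refl.
  have [b Ab be] := dist_le_vboundary aA nAe (dist_le_trans ad de).
  exists b => //; rewrite in_fset_set ?inE//; exact: finite_vboundary.
have h1 : #|` E|%:R <= c2%:R * (eps / k * (c1%:R * #|` D|%:R)).
  rewrite (le_trans (_ : _ <= c2%:R * #|` fset_set (vboundary [set` A])|%:R))//.
    by rewrite -natrM ler_nat.
  rewrite ler_wpM2l// (le_trans hA)// ler_wpM2l//.
    by rewrite divr_ge0 ?ltW.
  by rewrite -natrM ler_nat.
rewrite -(subnKC (fsubset_leq_card DD')) natrD mulrDl mul1r lerD2l -cE.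
rewrite (le_trans h1)//.
rewrite (_ : _ * _ = eps * #|` D|%:R * (c2%:R * c1%:R / k)); last by ring.
rewrite ler_piMr//; first by rewrite mulr_ge0// ltW.
by rewrite ler_pdivrMr// mul1r /k lerDl.
Qed.

(** The [R0]-thickening [A] of [D] has small boundary: a boundary point of [A]
    is within [R0] of some point of [X], which cannot be in [D] but is within
    [2 * R0 + 1] of it. *)
Lemma folner_amenable : folner X -> amenable_graph Gam R.
Proof.
move=> fol; apply/(amenable_graphP v0) => eps eps0.
have [c cP] := bb R0; pose k : R := c%:R + 1.
have k0 : 0 < k by rewrite ltr_wpDl.
have [D [D' [D0 DX D'P hD']]] := fol (R0.+1 + R0)%N (eps / k) (divr_gt0 eps0 k0).
have [A AP] := fset_thickening setT R0 D lf.
have DA : {subset D <= A}.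
  by move=> d dD; apply/AP; split => //; exists d => //; exact: dist_le_refl.
have DD' : (D `<=` D')%fset.
  apply/fsubsetP => d dD; apply/D'P; split; first exact: DX.
  by exists d => //; exact: dist_le_refl.
have := cardfsDS DD'; set E := (D' `\` D)%fset => cE.
exists A.
  have /fset0Pn[d dD] := D0; apply/fset0Pn; exists d; exact: DA.
have AE : (#|` fset_set (vboundary [set` A])| <= c * #|` E|)%N.
  apply: cP => x.
  rewrite in_fset_set ?inE; last exact: finite_vboundary.
  move=> [nAx [u /AP[_ [d dD du]] ux]].
  have [y Xy yx] := X_dense x; exists y => //.
  rewrite in_fsetD; apply/andP; split.
    by apply/negP => yD; apply: nAx; apply/AP; split => //; exists y.
  apply/D'P; split => //; exists d => //; apply: dist_le_trans (dist_le_sym yx).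
  by exists u => //; right.
have hE : #|` E|%:R <= eps / k * #|` D|%:R.
  move: hD'; rewrite -(subnKC (fsubset_leq_card DD')) natrD mulrDl mul1r.
  by rewrite lerD2l -cE.
rewrite (le_trans (_ : _ <= c%:R * #|` E|%:R))//; first by rewrite -natrM ler_nat.
rewrite (le_trans (ler_wpM2l _ hE))// mulrA.
apply: ler_pM => //; first by rewrite mulr_ge0// divr_ge0 ?ltW.
  rewrite mulrCA ger_pMr// ler_pdivrMr// mul1r /k lerDl//.
by rewrite ler_nat; apply/fsubset_leq_card/fsubsetP.
Qed.
End Folner.
End Distance.

(** * Topological groups and their Borel sets *)

Section TopologicalGroups.
Context (G : topologicalGroupType).
Implicit Types (g h x y : G) (A B K U : set G).

Lemma mull_continuous g : continuous (fun x => (g * x)%g).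
Proof.
move=> x.
have := @continuous2_cvg _ G G G (nbhs x) _ (fun=> g) id
  (fun a b : G => (a * b)%g) g x (@mulg_continuous G (g, x)).
apply; [exact: cvg_cst|exact: cvg_id].
Qed.

Lemma mulr_continuous g : continuous (fun x => (x * g)%g).
Proof.
move=> x.
have := @continuous2_cvg _ G G G (nbhs x) _ id (fun=> g)
  (fun a b : G => (a * b)%g) x g (@mulg_continuous G (x, g)).
apply; [exact: cvg_id|exact: cvg_cst].
Qed.

Lemma ltranslateE g A : ltranslate g A = [set x | A (g^-1 * x)%g].
Proof.
apply/seteqP; split=> [_ [a Aa <-]|x Ax] /=; first by rewrite mulKg.
by exists (g^-1 * x)%g => //; rewrite mulVKg.
Qed.

Lemma rtranslateE A g : rtranslate A g = [set x | A (x * g^-1)%g].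
Proof.
apply/seteqP; split=> [_ [a Aa <-]|x Ax] /=; first by rewrite mulgK.
by exists (x * g^-1)%g => //; rewrite mulgVK.
Qed.

Lemma rtranslateVK g (A : set G) : rtranslate (rtranslate A g^-1%g) g = A.
Proof.
by rewrite !rtranslateE; apply/seteqP; split=> x /=; rewrite invgK mulgVK.
Qed.

Lemma open_ltranslate g U : open U -> open (ltranslate g U).
Proof.
by rewrite ltranslateE => oU; apply: open_comp => // x _; exact: mull_continuous.
Qed.

Lemma open_rtranslate U g : open U -> open (rtranslate U g).
Proof.
by rewrite rtranslateE => oU; apply: open_comp => // x _; exact: mulr_continuous.
Qed.

Lemma compact_ltranslate g K : compact K -> compact (ltranslate g K).
Proof.
apply: continuous_compact; apply: continuous_subspaceT; exact: mull_continuous.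
Qed.

Lemma compact_rtranslate K g : compact K -> compact (rtranslate K g).
Proof.
apply: continuous_compact; apply: continuous_subspaceT; exact: mulr_continuous.
Qed.

Lemma compact_inv_preimage (K : set G) : compact K ->
  compact [set x | K x^-1%g].
Proof.
move=> cK.
have -> : [set x | K x^-1%g] = (fun x : G => x^-1%g) @` K.
  apply/seteqP; split=> [x Kx|_ [x Kx <-]] /=; last by rewrite invgK.
  by exists x^-1%g => //; rewrite invgK.
apply: continuous_compact => //; apply: continuous_subspaceT.
exact: invg_continuous.
Qed.

Lemma compact_mulset A B : compact A -> compact B -> compact (mulset A B).
Proof.
move=> cA cB.
have -> : mulset A B = (fun x : G * G => (x.1 * x.2)%g) @` (A `*` B).
  apply/seteqP; split=> [_ [a Aa [b Bb <-]]|_ [[a b] /= [Aa Bb] <-]].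
    by exists (a, b).
  by exists a => //; exists b.
apply: continuous_compact; last exact: compact_setX.
by apply: continuous_subspaceT; exact: mulg_continuous.
Qed.

Lemma open_measurable_borel U : open U -> measurable (U : set (borel G)).
Proof. exact: sub_sigma_algebra. Qed.

Lemma compact_measurable_borel K : hausdorff_space G -> compact K ->
  measurable (K : set (borel G)).
Proof.
move=> hG /(compact_closed hG) cK; rewrite -(setCK K); apply: measurableC.
by apply: open_measurable_borel; exact: closed_openC.
Qed.

Lemma continuous_measurable_borel (f : G -> G) : continuous f ->
  measurable_fun [set: borel G] (f : borel G -> borel G).
Proof.
move=> cf; apply: (@measurability _ _ (borel G) (borel G) setT f (@open G)) => //.
move=> _ [U oU <-]; rewrite setTI; apply: open_measurable_borel.
by apply: open_comp => // x _; exact: cf.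
Qed.

Lemma measurable_ltranslate g (A : set (borel G)) : measurable A ->
  measurable (ltranslate g A : set (borel G)).
Proof.
move=> mA; rewrite ltranslateE -[X in measurable X]setTI.
exact: (continuous_measurable_borel (@mull_continuous g^-1%g)).
Qed.

Lemma measurable_rtranslate g (A : set (borel G)) : measurable A ->
  measurable (rtranslate A g : set (borel G)).
Proof.
move=> mA; rewrite rtranslateE -[X in measurable X]setTI.
exact: (continuous_measurable_borel (@mulr_continuous g^-1%g)).
Qed.

Lemma nbhs1_divl (N : set G) : nbhs (1 : G)%g N ->
  exists V : set G, [/\ open V, V 1%g &
    forall a b, V a -> V b -> N (a^-1 * b)%g].
Proof.
move=> N1.
have c : {for ((1, 1)%g : G * G), continuous (fun x : G * G => (x.1^-1 * x.2)%g)}.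
  have := @continuous2_cvg _ G G G (nbhs ((1, 1)%g : G * G)) _
    (fun x : G * G => (x.1^-1)%g) snd (fun a b : G => (a * b)%g) (1^-1)%g 1%g
    (@mulg_continuous G (_, _)).
  apply; last exact: cvg_snd.
  by apply: continuous_cvg; [exact: invg_continuous|exact: cvg_fst].
have : nbhs ((1, 1)%g : G * G) ((fun x : G * G => (x.1^-1 * x.2)%g) @^-1` N).
  by apply: c; rewrite /= invg1 mulg1.
move=> [[A B] /= [A1 B1] AB].
have : nbhs (1 : G)%g (A `&` B) by exact: filterI.
rewrite nbhsE => -[V [oV V1] VAB]; exists V; split => // a b Va Vb.
by apply: (AB (a, b)); split; [case: (VAB a Va)|case: (VAB b Vb)].
Qed.

(** The shape [V^-1 V K] is that of the set of the points [y] such that [V y]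
    meets some [V k] with [k] in [K]. *)
Lemma compact_open_nbhs1 K U : compact K -> open U -> K `<=` U ->
  exists V : set G, [/\ open V, V 1%g & forall a b k, V a -> V b -> K k ->
    U (a^-1 * b * k)%g].
Proof.
move=> /compact_near_coveringP cK oU KU.
have N1 : nbhs (1 : G)%g [set a | K `<=` [set k | U (a * k)%g]].
  apply: (cK _ (nbhs (1 : G)%g) (fun a k => U (a * k)%g)) => k Kk.
  have := @mulg_continuous G (k, 1)%g.
  have := @mulg_continuous G (1, k)%g.
  move=> /(_ U) /=; rewrite mul1g => /(_ (open_nbhs_nbhs (conj oU (KU k Kk)))).
  move=> [[A B] /= [A1 Bk] AB] _.
  by exists (B, A) => // -[x a] /= [Bx Aa]; apply: (AB (a, x)).
have [V [oV V1 VN]] := nbhs1_divl N1; exists V; split => // a b k Va Vb.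
exact: VN.
Qed.

End TopologicalGroups.

(** * Counting against a measure *)

Section Count.
Context d (T : measurableType d) (R : realType).
Variables (mu : {measure set T -> \bar R}) (D : set T).
Hypothesis mD : measurable D.
Variables (I : Type) (s : seq I) (E : I -> set T).
Hypothesis mE : forall i, measurable (E i).

Let cnt x := count (fun i => `[< E i x >]) s.

Let cntE x : (\sum_(i <- s) (\1_(E i) x)%:E)%E = ((cnt x)%:R : R)%:E.
Proof.
rewrite sumEFin /cnt; congr EFin; elim: s => [|i t IH]; first by rewrite big_nil.
by rewrite big_cons IH /= natrD indicE /in_mem /= /in_set.
Qed.

Let mind i : measurable_fun D (fun x => (\1_(E i) x : R)%:E).
Proof. by apply/measurable_EFinP; exact: measurable_indic. Qed.

Let mcnt : measurable_fun D (fun x => ((cnt x)%:R : R)%:E).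
Proof.
under eq_fun do rewrite -cntE; exact: emeasurable_sum.
Qed.

Lemma integral_count :
  (\int[mu]_(x in D) ((cnt x)%:R)%:E = \sum_(i <- s) mu (E i `&` D))%E.
Proof.
under eq_integral do rewrite -cntE.
rewrite ge0_integral_sum//.
by apply: eq_bigr => i _; rewrite integral_indic.
Qed.

Lemma sum_measure_le N : (forall x, D x -> (cnt x <= N)%N) ->
  (\sum_(i <- s) mu (E i `&` D) <= N%:R%:E * mu D)%E.
Proof.
move=> cN; rewrite -integral_count -integral_cst//.
by apply: ge0_le_integral => // x Dx; rewrite lee_fin// ler_nat cN.
Qed.

Lemma sum_measure_ge N : (forall x, D x -> (N <= cnt x)%N) ->
  (N%:R%:E * mu D <= \sum_(i <- s) mu (E i `&` D))%E.
Proof.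
move=> cN; rewrite -integral_count -integral_cst//.
by apply: ge0_le_integral => // x Dx; rewrite lee_fin// ler_nat cN.
Qed.
End Count.

(** * Minimal coverings of a compact open subgroup *)

Section MinimalCovering.
Context (G : topologicalGroupType) (H : set G).
Hypotheses (HM : forall a b, H a -> H b -> H (a * b)%g)
  (HV : forall a, H a -> H (a^-1)%g).
Variable V : set G.

Definition covering (T : seq G) := (forall t, t \in T -> H t) /\
  forall x, H x -> exists2 t, t \in T & V (x * t^-1)%g.

(** In the covering by the [V t g], for [t] in [T], one may replace the
    centres in [K] by those centres [t h] of the covering by the [V t h] which
    lie in [U]: if [x] was in [V k] with [k] in [K], then the [V t h] that
    contains [x] meets [V k], so that [t h] is in [V^-1 V K].  By minimality
    of [T] the new centres are at least as many as those removed. *)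
Lemma minimal_covering_count (T : seq G) (K U : set G) :
  covering T -> (forall T', covering T' -> (size T <= size T')%N) ->
  (forall a b k, V a -> V b -> K k -> U (a^-1 * b * k)%g) ->
  forall g h, H g -> H h ->
  (count (fun t => `[< K (t * g)%g >]) T <=
   count (fun t => `[< U (t * h)%g >]) T)%N.
Proof.
move=> [TH Tcov] Tmin KU g h Hg Hh.
set PK := fun t => `[< K (t * g)%g >]; set PU := fun t => `[< U (t * h)%g >].
pose T' := [seq t * h | t <- T & PU t]%g ++ [seq t * g | t <- T & predC PK t]%g.
have /Tmin : covering T'.
  split.
    move=> t; rewrite mem_cat => /orP[] /mapP[u];
      rewrite mem_filter => /andP[_ /TH Hu] ->; exact: HM.
  move=> x Hx.
  have [t tT] := Tcov _ (HM Hx (HV Hh)).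
  rewrite -mulgA -invgM => Vt.
  have [u uT] := Tcov _ (HM Hx (HV Hg)).
  rewrite -mulgA -invgM => Vu.
  have [/asboolP Kug|nKug] := boolP (PK u).
    exists (t * h)%g => //; rewrite mem_cat; apply/orP; left.
    apply: (map_f (fun t => t * h)%g); rewrite mem_filter tT andbT.
    apply/asboolP; have := KU _ _ _ Vt Vu Kug.
    move: (t * h)%g (u * g)%g => a b.
    by rewrite -mulgA mulgVK invgM invgK mulgVK.
  exists (u * g)%g => //; rewrite mem_cat; apply/orP; right.
  by apply: (map_f (fun t => t * g)%g); rewrite mem_filter /= nKug.
rewrite size_cat !size_map !size_filter -(count_predC PK T).
by rewrite leq_add2r.
Qed.

Lemma minimal_covering : compact H -> open V -> V 1%g ->
  exists2 T, covering T & forall T', covering T' -> (size T <= size T')%N.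
Proof.
move=> cH oV V1.
have [T0 T0P] : exists T, covering T.
  move: cH; rewrite compact_cover => /(_ G H (fun t => rtranslate V t)).
  case=> [t _|x Hx|T TH HT].
  - exact: open_rtranslate.
  - by exists x => //; rewrite rtranslateE /= mulgV.
  exists (enum_fset T); split => [t tT|x /HT[t tT]].
    by have := TH t tT; rewrite inE.
  by rewrite rtranslateE => Vx; exists t.
have ex : exists n, `[< exists2 T, covering T & size T = n >].
  by exists (size T0); apply/asboolP; exists T0.
have [n /asboolP[T Tc Tn] nmin] := ex_minnP ex; exists T => // T' T'c.
by rewrite Tn; apply: nmin; apply/asboolP; exists T'.
Qed.
End MinimalCovering.

(** * Uniqueness of Haar measure *)

Section HaarUnique.
Context (R : realType) (G : topologicalGroupType).
Hypothesis hG : hausdorff_space G.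
Implicit Types mu nu : {measure set (borel G) -> \bar R}.
Variable H : set G.
Hypotheses (cH : compact H) (oH : open H) (H1 : H 1%g)
  (HM : forall a b, H a -> H b -> H (a * b)%g)
  (HV : forall a, H a -> H (a^-1)%g).

(** The sum over [t] in [T] of the measures of the translates of [K] by [t^-1]
    is the integral over [g] in [H] of the number of [t] with [t g] in [K], so
    [minimal_covering_count] compares it for [mu] with the same sum for [U]
    and [nu]. *)
Lemma haar_compact_open mu nu K U : left_haar_measure mu ->
  left_haar_measure nu -> compact K -> K `<=` H -> open U -> K `<=` U ->
  (mu K * nu H <= nu U * mu H)%E.
Proof.
move=> hmu hnu cK KH oU0 KU0.
pose U1 := U `&` H.
have oU : open U1 by exact: openI.
have KU : K `<=` U1 by move=> k Kk; split; [exact: KU0|exact: KH].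
have mH : measurable (H : set (borel G)) by exact: open_measurable_borel.
have mK : measurable (K : set (borel G)) by exact: compact_measurable_borel.
have mU : measurable (U1 : set (borel G)) by exact: open_measurable_borel.
have mU0 : measurable (U : set (borel G)) by exact: open_measurable_borel.
have [V [oV V1 VKU]] := compact_open_nbhs1 cK oU KU.
have [T Tc Tmin] := minimal_covering cH oV V1.
have cnt := minimal_covering_count HM HV Tc Tmin VKU.
(* The least value [N] over [h] of the count for [U1] separates the counts
   for [K] from those for [U1]. *)
have ex : exists n, `[< exists2 h, H h &
    count (fun t => `[< U1 (t * h)%g >]) T = n >].
  by eexists; apply/asboolP; exists 1%g.
have [N /asboolP[h0 Hh0 hN] Nmin] := ex_minnP ex.
pose E (A : set G) t : set (borel G) := ltranslate (t^-1)%g A.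
have EE A t x : E A t x = A (t * x)%g by rewrite /E ltranslateE /= invgK.
(* Translating by elements of the subgroup [H] turns each term of the sums
   below into the measure of one and the same set. *)
have sumE (la : {measure set (borel G) -> \bar R}) (A : set G) :
    left_haar_measure la -> measurable (A : set (borel G)) -> A `<=` H ->
    (\sum_(t <- T) la (E A t `&` H) = (size T)%:R%:E * la A)%E.
  move=> hla mA AH.
  rewrite (eq_big_seq (fun=> la A)).
    by rewrite big_const_seq count_predT iter_addr_0 ?mule_natl.
  move=> t tT /=.
  rewrite setIidl ?haar_invariant// => x; rewrite EE => /AH Htx.
  by rewrite -(mulKg t x); apply: HM => //; apply: HV; exact: Tc.1.
have leK : ((size T)%:R%:E * mu K <= N%:R%:E * mu H)%E.
  rewrite -sumE//; apply: sum_measure_le => //.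
    by move=> t; exact: measurable_ltranslate.
  move=> x Hx; rewrite -hN (leq_trans _ (cnt _ _ Hx Hh0))//.
  by apply: sub_count => t; rewrite EE.
have geU : (N%:R%:E * nu H <= (size T)%:R%:E * nu U1)%E.
  rewrite -sumE//; last by move=> x [].
  apply: sum_measure_ge => //.
    by move=> t; exact: measurable_ltranslate.
  move=> x Hx; apply: Nmin; apply/asboolP; exists x => //.
  by apply: eq_count => t; rewrite EE.
have T0 : (0 < size T)%N.
  have [t tT _] := Tc.2 _ H1; by case: (T) tT.
have fin (la : {measure set (borel G) -> \bar R}) (A : set (borel G)) :
    left_haar_measure la -> measurable A -> A `<=` H -> la A \is a fin_num.
  move=> hla mA AH; rewrite ge0_fin_numE//.
  rewrite (@le_lt_trans _ _ (la H))//; last exact: haar_compact.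
  by apply: le_measure => //; rewrite inE.
apply: (@le_trans _ _ (nu U1 * mu H)%E); last first.
  by rewrite lee_wpmul2r//; apply: le_measure; rewrite ?inE// => x [].
move: leK geU.
rewrite -(fineK (fin mu K _ _ _))// -(fineK (fin mu H _ _ _))//.
rewrite -(fineK (fin nu H _ _ _))// -(fineK (fin nu U1 _ _ _))//; last first.
  by move=> x [].
rewrite -!EFinM !lee_fin.
have : 0 <= fine (nu H) by exact: fine_ge0.
have : 0 <= fine (mu H) by exact: fine_ge0.
move: (fine (mu K)) (fine (mu H)) (fine (nu H)) (fine (nu U1)) => a b c e b0 c0.
move=> h1 h2; rewrite -(@ler_pM2l _ (size T)%:R) ?ltr0n//.
by have := ler_wpM2r c0 h1; have := ler_wpM2l b0 h2; lra.
Qed.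

Lemma compact_translate_cover K : compact K ->
  exists s : seq G, forall x, K x -> exists2 t, t \in s & ltranslate t H x.
Proof.
rewrite compact_cover => /(_ G setT (fun t => ltranslate t H)); case.
- by move=> t _; exact: open_ltranslate.
- by move=> x _; exists x => //; rewrite ltranslateE /= mulVg.
- by move=> T _ KT; exists (enum_fset T) => x /KT[t tT Htx]; exists t.
Qed.

(** Otherwise finitely many translates of [H] show that all compact sets are
    null, and inner regularity that the whole group is null. *)
Lemma haar_open_gt0 mu : left_haar_measure mu -> (0 < mu H)%E.
Proof.
move=> hmu; rewrite lt0e measure_ge0 andbT; apply/eqP => mH0.
apply: (haar_neq0 hmu); apply/eqP; rewrite eq_le measure_ge0 andbT.
rewrite (haar_inner_regular hmu); last exact: openT.
apply: ge_ereal_sup => _ [K [cK _] <-].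
have [s Ks] := compact_translate_cover cK.
have mtH t : measurable (ltranslate t H : set (borel G)).
  by apply: open_measurable_borel; exact: open_ltranslate.
have mK : measurable (K : set (borel G)) by exact: compact_measurable_borel.
have mU : measurable (\big[setU/set0]_(t <- s) (ltranslate t H : set (borel G))).
  exact: bigsetU_measurable.
apply: (@le_trans _ _ (mu (\big[setU/set0]_(t <- s) ltranslate t H))).
  apply: le_measure; rewrite ?inE// => x /Ks[t ts tHx].
  by rewrite -bigcup_seq; exists t.
rewrite (big_nth 1%g) big_mkord.
apply: (le_trans (Boole_inequality mu (fun n _ => mtH (nth 1%g s n)))).
rewrite big1// => t _; rewrite -mH0; apply: (haar_invariant hmu).
exact: open_measurable_borel.
Qed.

(** The left cosets of [H] are open and closed, which allows cutting both [K]
    and [U] along finitely many of them and translating each piece into [H]. *)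
Lemma haar_compact_open_cosets mu nu (s : seq G) K U : left_haar_measure mu ->
  left_haar_measure nu -> compact K ->
  (forall x, K x -> exists2 t, t \in s & ltranslate t H x) ->
  open U -> K `<=` U -> (mu K * nu H <= nu U * mu H)%E.
Proof.
move=> hmu hnu; elim: s K U => [|t s IH] K U cK Ks oU KU.
  have -> : K = set0 by apply/seteqP; split => // x /Ks[].
  by rewrite measure0 mul0e mule_ge0.
have oL : open (ltranslate t H) by exact: open_ltranslate.
have cL : closed (ltranslate t H).
  by apply: compact_closed => //; exact: compact_ltranslate.
have mL : measurable (ltranslate t H : set (borel G)).
  exact: open_measurable_borel.
have mK : measurable (K : set (borel G)) by exact: compact_measurable_borel.
have mU : measurable (U : set (borel G)) by exact: open_measurable_borel.
have cKL : compact (K `&` ltranslate t H) by exact: compact_closedI.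
have cKD : compact (K `\` ltranslate t H).
  by apply: compact_closedI => //; exact: open_closedC.
have oUL : open (U `&` ltranslate t H) by exact: openI.
have oUD : open (U `\` ltranslate t H) by apply: openI => //; exact: closed_openC.
have -> : mu K = (mu (K `\` ltranslate t H) + mu (K `&` ltranslate t H))%E.
  exact: measureDI.
have -> : nu U = (nu (U `\` ltranslate t H) + nu (U `&` ltranslate t H))%E.
  exact: measureDI.
rewrite ge0_muleDl// ge0_muleDl//; apply: leeD.
  apply: IH => //; last by move=> x [/KU].
  move=> x [/Ks[u]]; rewrite inE => /orP[/eqP ->//|us uH _].
  by exists u.
rewrite -(haar_invariant hmu t^-1%g (A := K `&` _)); last exact: measurableI.
rewrite -(haar_invariant hnu t^-1%g (A := U `&` _)); last exact: measurableI.
apply: haar_compact_open => //.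
- exact: compact_ltranslate.
- by move=> x; rewrite !ltranslateE /= invgK mulKg => -[].
- exact: open_ltranslate.
- by move=> x; rewrite !ltranslateE /= => -[/KU].
Qed.

Lemma haar_fin_num mu K : left_haar_measure mu -> compact K -> mu K \is a fin_num.
Proof. by move=> hmu cK; rewrite ge0_fin_numE//; exact: haar_compact. Qed.

(** Inner regularity of [mu]
    gives the inequality for open sets, and outer regularity of [nu] then gives
    it for Borel sets. *)
Lemma haar_unique_le mu nu (A : set (borel G)) : left_haar_measure mu ->
  left_haar_measure nu -> measurable A -> (mu A * nu H <= nu A * mu H)%E.
Proof.
move=> hmu hnu mA.
have [muH nuH] := (haar_open_gt0 hmu, haar_open_gt0 hnu).
have [fmu fnu] := (haar_fin_num hmu cH, haar_fin_num hnu cH).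
have leU U : open U -> (mu U * nu H <= nu U * mu H)%E.
  move=> oU; rewrite -(fineK fnu) -lee_pdivlMr ?fine_gt0 ?nuH ?ltey_eq ?fnu//.
  rewrite (haar_inner_regular hmu oU); apply: ge_ereal_sup => _ [K [cK KU] <-].
  rewrite lee_pdivlMr ?fine_gt0 ?nuH ?ltey_eq ?fnu// fineK//.
  have [s Ks] := compact_translate_cover cK.
  exact: haar_compact_open_cosets Ks _ _.
rewrite -(fineK fmu) -lee_pdivrMr ?fine_gt0 ?muH ?ltey_eq ?fmu//.
rewrite (haar_outer_regular hnu mA); apply/ereal_infP => _ [U [oU AU] <-].
rewrite lee_pdivrMr ?fine_gt0 ?muH ?ltey_eq ?fmu// fineK//.
apply: le_trans (leU _ oU); rewrite lee_wpmul2r//.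
by apply: le_measure; rewrite ?inE//; exact: open_measurable_borel.
Qed.

(** The products with the masses of [H] stand for the constant ratio between
    the two measures. *)
Lemma haar_unique mu nu (A : set (borel G)) : left_haar_measure mu ->
  left_haar_measure nu -> measurable A -> (mu A * nu H = nu A * mu H)%E.
Proof.
by move=> hmu hnu mA; apply/eqP; rewrite eq_le !haar_unique_le.
Qed.

Lemma haar_rtranslate mu g : left_haar_measure mu ->
  exists2 nu : {measure set (borel G) -> \bar R}, left_haar_measure nu &
    forall A, nu A = mu (rtranslate A g).
Proof.
move=> hmu.
have mf := continuous_measurable_borel (@mulr_continuous G (g^-1)%g).
have [nu nuP] : exists nu : {measure set (borel G) -> \bar R},
    forall A, nu A = mu (rtranslate A g).
  unshelve (exists (pushforward mu (fun x : borel G => (x * g^-1)%g : borel G))).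
    exact: mf.
  by move=> A; rewrite rtranslateE.
exists nu => //; split.
- by rewrite nuP rtranslateE; exact: (haar_neq0 hmu).
- move=> h A mA; rewrite !nuP.
  rewrite -(haar_invariant hmu h (measurable_rtranslate g mA)).
  by congr (mu _); rewrite !ltranslateE !rtranslateE; apply/seteqP;
    split=> x /=; rewrite mulgA.
- move=> K cK; rewrite nuP; apply: (haar_compact hmu).
  exact: compact_rtranslate.
- move=> A mA; rewrite nuP.
  rewrite (haar_outer_regular hmu (measurable_rtranslate g mA)).
  congr ereal_inf; apply/seteqP; split => _ [U [oU AU] <-].
    exists (rtranslate U g^-1%g).
      split; first exact: open_rtranslate.
      by move=> x Ax; rewrite rtranslateE /= invgK; apply: AU; exists x.
    by rewrite nuP rtranslateVK.
  exists (rtranslate U g); last by rewrite nuP.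
  by split; [exact: open_rtranslate|move=> _ [x /AU Ux <-]; exists x].
- move=> U oU; rewrite nuP.
  rewrite (haar_inner_regular hmu (open_rtranslate g oU)).
  congr ereal_sup; apply/seteqP; split => _ [K [cK KU] <-].
    exists (rtranslate K g^-1%g).
      split; first exact: compact_rtranslate.
      by move=> _ [x /KU [y Uy <-] <-]; rewrite mulgK.
    by rewrite nuP rtranslateVK.
  exists (rtranslate K g); last by rewrite nuP.
  by split; [exact: compact_rtranslate|move=> _ [x /KU Ux <-]; exists x].
Qed.
End HaarUnique.

(** * Continuous actions on graphs *)

Lemma finite_uniform (T : choiceType) (S : set T) (P : T -> nat -> Prop) :
  finite_set S -> (forall v m n, (m <= n)%N -> P v m -> P v n) ->
  (forall v, exists n, P v n) -> exists n, forall v, S v -> P v n.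
Proof.
move=> fS Pmono /choice[f fP]; exists (\max_(v <- fset_set S) f v)%N => v Sv.
apply: (Pmono _ (f v)) => //; apply: (@leq_bigmax_seq _ _ xpredT f v) => //.
by rewrite in_fset_set ?inE.
Qed.

(* Orbits of an action, rather than those of a self-map. *)
Local Notation orbit := Defs.orbit.

Section Action.
Context (G : topologicalGroupType) (Gam : graph) (act : G -> Gam -> Gam).
Hypothesis hact : graph_action act.
Implicit Types (u v w o : Gam) (D : set Gam).

Lemma actV1 g v : act g^-1%g (act g v) = v.
Proof. by rewrite -(actM hact) mulVg (act1 hact). Qed.

Lemma act1V g v : act g (act g^-1%g v) = v.
Proof. by rewrite -(actM hact) mulgV (act1 hact). Qed.

Lemma dist_le_act r g u v : dist_le r u v -> dist_le r (act g u) (act g v).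
Proof.
elim: r v => [v <-//|r IH v [w uw wv]]; exists (act g w); first exact: IH.
by case: wv => [->|wv]; [left|right; rewrite (act_adj hact)].
Qed.

Lemma open_act_preimage v D : open [set g | D (act g v)].
Proof.
pose f : G -> discrete_topology Gam :=
  @proj Gam (fun=> discrete_topology Gam) v \o
    (act : G -> {ptws Gam -> discrete_topology Gam}).
have cf : continuous f.
  move=> g; have ag := @act_continuous _ _ _ hact g.
  have pc := @proj_continuous Gam (fun=> discrete_topology Gam) v (act g).
  exact: (@continuous_comp _ _ _ _ _ _ ag pc).
exact: (@open_comp G (discrete_topology Gam) f D (fun x _ => cf x)
  (discrete_open _)).
Qed.

(** [K] is covered by the disjoint open sets where [g v] is constant. *)
Lemma compact_orbit_finite v (K : set G) : compact K ->
  finite_set [set act k v | k in K].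
Proof.
rewrite compact_cover => /(_ Gam setT (fun w => [set g | act g v = w])); case.
- by move=> w _; exact: (open_act_preimage v [set w]).
- by move=> k _; exists (act k v).
move=> T _ KT; apply: (@sub_finite_set _ _ [set` T]) => // _ [k /KT[w wT kw] <-].
by rewrite kw.
Qed.

Lemma orbit_act g v : orbit act (act g v) = orbit act v.
Proof.
apply/seteqP; split=> _ [h _ <-]; first by exists (h * g)%g; rewrite ?(actM hact).
by exists (h * g^-1)%g => //; rewrite (actM hact) actV1.
Qed.

Lemma self_orbit v : orbit act v v.
Proof. by exists 1%g => //; exact: act1. Qed.

Lemma orbit_eq v w : orbit act v w -> orbit act w = orbit act v.
Proof. by move=> [g _ <-]; exact: orbit_act. Qed.

(** There are finitely many orbits, so one value of [n] serves for a
    representative of each. *)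
Lemma quasitransitive_uniform (P : Gam -> nat -> Prop) : quasitransitive act ->
  (forall v m n, (m <= n)%N -> P v m -> P v n) ->
  (forall g v n, P v n -> P (act g v) n) ->
  (forall v, exists n, P v n) -> exists n, forall v, P v n.
Proof.
move=> qt Pmono Pact Pex.
have [[v0 _]|Gam0] := pselect (exists v : Gam, True); last first.
  by exists 0%N => v; case: Gam0; exists v.
pose rep S := xget v0 [set v | orbit act v = S].
have [n nP] := finite_uniform (finite_image rep qt) Pmono Pex.
exists n => v.
have rv : orbit act (rep (orbit act v)) = orbit act v.
  by rewrite /rep; case: xgetP => [w _ //|/(_ v)[]].
have [g _ <-] : orbit act (rep (orbit act v)) v by rewrite rv; exact: self_orbit.
by apply: Pact; apply: nP; exists (orbit act v) => //; exists v.
Qed.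

Lemma quasitransitive_bounded_balls : locally_finite Gam ->
  quasitransitive act -> bounded_balls Gam.
Proof.
move=> lf qt r.
have [|||c cP] := @quasitransitive_uniform
    (fun v c => #|` fset_set [set w | dist_le r v w]| <= c)%N qt.
- by move=> v m n mn /leq_trans; apply.
- move=> g v n; apply: leq_trans.
  have -> : [set w | dist_le r (act g v) w] = act g @` [set w | dist_le r v w].
    apply/seteqP; split=> [w vw|_ [w vw <-]]; last exact: dist_le_act.
    exists (act g^-1%g w); last by rewrite act1V.
    by rewrite /= -[v](actV1 g); exact: dist_le_act.
  rewrite fset_set_image; last exact: finite_ball.
  exact: leq_imfset_card.
- by move=> v; eexists; exact: leqnn.
by exists c; exact: card_covering.
Qed.

Lemma quasitransitive_dense o : connected_graph Gam -> quasitransitive act ->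
  exists r, forall v, exists2 x, orbit act o x & dist_le r x v.
Proof.
move=> conn qt; apply: quasitransitive_uniform => //.
- by move=> v m n mn [x ox xv]; exists x => //; exact: dist_leW xv.
- move=> g v n [x ox xv]; exists (act g x); last exact: dist_le_act.
  by rewrite -(orbit_eq ox); exists g.
- move=> v; have [r rov] := connected_dist_le conn o v.
  by exists r, o => //; exact: self_orbit.
Qed.

Lemma stabiliserM v a b : stabiliser act v a -> stabiliser act v b ->
  stabiliser act v (a * b)%g.
Proof. by move=> av bv; rewrite /stabiliser /= (actM hact) bv. Qed.

Lemma stabiliserV v a : stabiliser act v a -> stabiliser act v a^-1%g.
Proof. by move=> av; rewrite /stabiliser /= -{1}av actV1. Qed.

Lemma stabiliser1 v : stabiliser act v 1%g.
Proof. exact: act1. Qed.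

Lemma open_stabiliser v : open (stabiliser act v).
Proof. exact: (open_act_preimage v [set v]). Qed.

Lemma transporterE v g :
  [set x | act x v = act g v] = ltranslate g (stabiliser act v).
Proof.
rewrite ltranslateE; apply/seteqP; split=> x; rewrite /stabiliser /=.
  by rewrite (actM hact) => ->; rewrite actV1.
by rewrite (actM hact) => {2}<-; rewrite act1V.
Qed.

Lemma stabiliser_conj v g :
  stabiliser act (act g^-1%g v) = ltranslate g^-1%g (rtranslate (stabiliser act v) g).
Proof.
rewrite ltranslateE rtranslateE; apply/seteqP; split=> x; rewrite /stabiliser /=.
  by rewrite invgK !(actM hact) => ->; rewrite act1V.
by rewrite invgK !(actM hact) => {2}<-; rewrite actV1.
Qed.

Section Proper.
Hypothesis pact : proper_action act.

Lemma compact_act_preimage v (E : {fset Gam}) :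
  {subset E <= orbit act v} -> compact [set x | act x v \in E].
Proof.
move=> EX.
have -> : [set x | act x v \in E] =
    \bigcup_(w in [set` E]) [set x | act x v = w].
  by apply/seteqP; split=> [x xE|x [w wE /= ->]//]; exists (act x v).
rewrite bigcup_fset big_seq; apply: bigsetU_compact => w /EX.
by rewrite inE => -[g _ <-]; rewrite transporterE; exact: compact_ltranslate.
Qed.

Context (R : realType) (mu : {measure set (borel G) -> \bar R}).
Hypotheses (hG : hausdorff_space G) (hmu : left_haar_measure mu).

Lemma measure_fibres (F : Gam -> set (borel G)) (E : {fset Gam}) m :
  trivIset setT F -> (forall w, w \in E -> measurable (F w)) ->
  (forall w, w \in E -> mu (F w) = m) ->
  mu (\bigcup_(w in [set` E]) F w) = (#|` E|%:R%:E * m)%E.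
Proof.
move=> tF mF muF.
rewrite measure_fin_bigcup//; last exact: sub_trivIset tF.
rewrite fsbig_finite// set_fsetK (eq_big_seq (fun=> m))//.
by rewrite big_const_seq count_predT iter_addr_0 mule_natl.
Qed.

Lemma measure_act_preimage v (E : {fset Gam}) : {subset E <= orbit act v} ->
  mu [set x | act x v \in E] = (#|` E|%:R%:E * mu (stabiliser act v))%E.
Proof.
move=> EX.
have -> : [set x | act x v \in E] =
    \bigcup_(w in [set` E]) [set x | act x v = w].
  by apply/seteqP; split=> [x xE|x [w wE /= ->]//]; exists (act x v).
apply: measure_fibres.
- by apply/trivIsetP => w1 w2 _ _ /eqP w12; apply/seteqP; split => // x [/= -> ].
- by move=> w _; apply: open_measurable_borel; exact: (open_act_preimage v [set w]).
move=> w /EX; rewrite inE => -[g _ <-]; rewrite transporterE haar_invariant//.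
apply: open_measurable_borel; exact: open_stabiliser.
Qed.

Lemma stabiliser_gt0 v : (0 < mu (stabiliser act v))%E.
Proof.
apply: haar_open_gt0 => //; [exact: open_stabiliser|exact: stabiliser1].
Qed.

Lemma stabiliser_fin v : mu (stabiliser act v) \is a fin_num.
Proof. exact: haar_fin_num. Qed.

End Proper.
End Action.

(** * Sets of small growth in an orbit *)

Section OrbitGrowth.
Context (R : realType) (Gam : graph) (G : topologicalGroupType)
  (mu : {measure set (borel G) -> \bar R}) (act : G -> Gam -> Gam).
Hypotheses (conn : connected_graph Gam) (lf : locally_finite Gam)
  (hG : hausdorff_space G) (hmu : left_haar_measure mu)
  (hact : graph_action act) (pact : proper_action act).
Implicit Types (u v o : Gam) (K U : set G).

Definition right_invariant := forall g (A : set (borel G)), measurable A ->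
  mu (rtranslate A g) = mu A.

Lemma unimodularP : unimodular mu <-> right_invariant.
Proof.
split=> [[Delta [_ DeltaP] Delta1] g A mA|rinv].
  by rewrite DeltaP// Delta1 mul1e.
exists (fun=> 1) => //; split => // g A mA.
by rewrite rinv// mul1e.
Qed.

(** With [r] the distance from [v] to [o], an [x] with [x v] in [D] moves [o]
    into the [r]-thickening of [D]; compare the measures of the two sets of
    such [x], which are unions of cosets of the two stabilisers. *)
Lemma folner_stabiliser_le o v : folner R (orbit act o) -> orbit act o v ->
  (mu (stabiliser act v) <= mu (stabiliser act o))%E.
Proof.
move=> fol ov.
have [fo fv] := (stabiliser_fin pact hmu o, stabiliser_fin pact hmu v).
have o0 := stabiliser_gt0 hact hG hmu o.
have [r rvo] := connected_dist_le conn v o.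
rewrite -(fineK fo) -(fineK fv) lee_fin.
set a := fine (mu (stabiliser act v)); set b := fine (mu (stabiliser act o)).
have b0 : 0 < b by rewrite fine_gt0// o0 ltey_eq fo.
apply/ler_addgt0Pr => eps eps0.
have [D [D' [D0 DX D'P hD']]] := fol r (eps / b) (divr_gt0 eps0 b0).
have : (mu [set x | act x v \in D] <= mu [set x | act x o \in D'])%E.
  apply: le_measure; rewrite ?inE.
  - apply: open_measurable_borel; exact: (open_act_preimage hact v [set` D]).
  - apply: open_measurable_borel; exact: (open_act_preimage hact o [set` D']).
  - move=> x /= xD; apply/D'P; split; first by exists x.
    by exists (act x v) => //; exact: dist_le_act.
rewrite (measure_act_preimage hact hmu); last first.
  by move=> x xD; rewrite inE (orbit_eq hact ov); exact: DX.
rewrite (measure_act_preimage hact hmu); last first.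
  by move=> x /D'P[]; rewrite inE.
rewrite -(fineK fo) -(fineK fv) -!EFinM lee_fin -/a -/b => hab.
have D_gt0 : 0 < #|` D|%:R :> R by rewrite ltr0n cardfs_gt0.
rewrite -(ler_pM2l D_gt0) (le_trans hab)//.
rewrite (le_trans (ler_wpM2r (ltW b0) hD'))//.
rewrite (_ : _ * b = #|` D|%:R * (b + eps))// mulrAC mulrDl mul1r mulfVK ?gt_eqF//.
by rewrite mulrC.
Qed.

(** The stabiliser of [g^-1 o] is [g^-1 H g], so the equality of the measures
    of the stabilisers says that [H g] has the measure of [H]; by uniqueness of
    Haar measure the right translate of [mu] by [g] is then [mu]. *)
Lemma folner_right_invariant o : folner R (orbit act o) -> right_invariant.
Proof.
move=> fol g A mA; set H := stabiliser act o.
have oH : open H := open_stabiliser hact o.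
have mH : measurable (H : set (borel G)) by exact: open_measurable_borel.
have ov : orbit act o (act g^-1%g o) by exists g^-1%g.
have muHg : mu (rtranslate H g) = mu H.
  rewrite -(haar_invariant hmu g^-1%g (measurable_rtranslate g mH)).
  rewrite -stabiliser_conj//; apply/eqP; rewrite eq_le folner_stabiliser_le//=.
  apply: folner_stabiliser_le; first by rewrite (orbit_eq hact ov).
  by rewrite (orbit_eq hact ov); exact: self_orbit.
have [nu hnu nuE] := haar_rtranslate g hmu.
have cH : compact H by exact: pact.
have := haar_unique hG cH oH (stabiliser1 hact o) (stabiliserM hact (v:=o))
  (stabiliserV hact (v:=o)) hmu hnu mA.
rewrite !nuE muHg => h.
have H0 : (0 < mu H)%E by exact: stabiliser_gt0.
have Hfin : mu H \is a fin_num by exact: stabiliser_fin.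
apply/eqP; rewrite eq_le; apply/andP; split.
  by rewrite -(@lee_pmul2r _ (mu H))// h.
by rewrite -(@lee_pmul2r _ (mu H))// h.
Qed.

Section RightInvariant.
Hypothesis rinv : right_invariant.

Lemma measure_actV_preimage o (E : {fset Gam}) : {subset E <= orbit act o} ->
  mu [set x | act x^-1%g o \in E] = (#|` E|%:R%:E * mu (stabiliser act o))%E.
Proof.
move=> EX.
have -> : [set x | act x^-1%g o \in E] =
    \bigcup_(w in [set` E]) [set x | act x^-1%g o = w].
  by apply/seteqP; split=> [x xE|x [w wE /= ->]//]; exists (act x^-1%g o).
have transpE g : [set x | act x^-1%g o = act g o] =
    rtranslate (stabiliser act o) g^-1%g.
  rewrite rtranslateE; apply/seteqP; split=> x;
    rewrite /stabiliser /= invgK (actM hact).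
    by move=> <-; rewrite act1V.
  by move=> {1}<-; rewrite actV1.
have mH : measurable (stabiliser act o : set (borel G)).
  by apply: open_measurable_borel; exact: open_stabiliser.
apply: measure_fibres.
- by apply/trivIsetP => w1 w2 _ _ /eqP w12; apply/seteqP; split => // x [/= -> ].
- move=> w /EX; rewrite inE => -[g _ <-]; rewrite transpE.
  exact: measurable_rtranslate.
- by move=> w /EX; rewrite inE => -[g _ <-]; rewrite transpE rinv.
Qed.

Lemma compact_actV_preimage o (E : {fset Gam}) : {subset E <= orbit act o} ->
  compact [set x | act x^-1%g o \in E].
Proof. by move=> EX; exact: compact_inv_preimage (compact_act_preimage hact pact EX). Qed.

(** The set of the [x] with [x^-1 o] in [D] is almost invariant under [K]: if
    [k^-1 o] is within [r] of [o] for all [k] in [K], then [(k x)^-1 o] is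
    within [r] of [x^-1 o]. *)
Lemma folner_amenable_group o : folner R (orbit act o) -> amenable_group mu.
Proof.
move=> fol K cK eps eps0.
have [r Kr] : exists r, forall k, K k -> dist_le r o (act k^-1%g o).
  have fK := compact_orbit_finite hact o (compact_inv_preimage cK).
  have [r rP] := finite_uniform fK (fun v m n mn => dist_leW mn)
    (connected_dist_le conn o).
  by exists r => k Kk; apply: rP; exists k^-1%g => //=; rewrite invgK.
have [D [D' [D0 DX D'P hD']]] := fol r eps eps0.
have DX' : {subset D <= orbit act o} by move=> d dD; rewrite inE; exact: DX.
have D'X : {subset D' <= orbit act o} by move=> d /D'P[]; rewrite inE.
have H0 := stabiliser_gt0 hact hG hmu o.
have Hfin := stabiliser_fin pact hmu o.
have b0 : 0 < fine (mu (stabiliser act o)) by rewrite fine_gt0// H0 ltey_eq Hfin.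
have D_gt0 : 0 < #|` D|%:R :> R by rewrite ltr0n cardfs_gt0.
have cU := compact_actV_preimage DX'.
exists [set x | act x^-1%g o \in D]; split => //.
  by rewrite measure_actV_preimage// mule_gt0// lte_fin.
have KUD' : (mu (mulset K [set x | act x^-1%g o \in D]) <=
    mu [set x | act x^-1%g o \in D'])%E.
  apply: le_measure; rewrite ?inE.
  - by apply: compact_measurable_borel => //; exact: compact_mulset.
  - apply: compact_measurable_borel => //; exact: compact_actV_preimage.
  - move=> _ [k Kk [u /= uD <-]]; apply/D'P; rewrite invgM (actM hact).
    split; first by exists (u^-1 * k^-1)%g => //; rewrite (actM hact).
    by exists (act u^-1%g o) => //; apply: dist_le_act => //; exact: Kr.
move: KUD'; rewrite !measure_actV_preimage// -(fineK Hfin) -!EFinM => KUD'.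
rewrite inver gt_eqF ?mulr_gt0// lee_pdivrMr ?mulr_gt0//.
rewrite (le_trans KUD')// -EFinM lee_fin mulrA ler_wpM2r// ltW//.
Qed.

(** Let [K] be the set of the [x] that satisfy [x^-1 o \in B], where [B] is the
    trace on the orbit of the ball of radius [r] around [o].  If [x^-1 o] is
    within [r] of [u^-1 o] then [x u^-1] is in [K]; so a set [U] almost
    invariant under [K] yields the slowly growing set of the [u^-1 o]. *)
Lemma amenable_group_folner o : amenable_group mu -> folner R (orbit act o).
Proof.
move=> am r eps eps0.
have [B BP] := fset_thickening (orbit act o) r [fset o]%fset lf.
have BX : {subset B <= orbit act o} by move=> x /BP[]; rewrite inE.
have cK := compact_actV_preimage BX.
have [U [cU U0 hU]] := am _ cK _ eps0.
have fU := compact_orbit_finite hact o (compact_inv_preimage cU).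
have [D DP] : exists D : {fset Gam},
    forall x, x \in D <-> exists2 u, U u & act u^-1%g o = x.
  exists (fset_set [set act k o | k in [set x | U x^-1%g]]) => x.
  rewrite (in_fset_set fU) inE; split => -[u Uu <-].
    by exists u^-1%g => //; rewrite invgK.
  by exists u^-1%g => //=; rewrite invgK.
have DX : {subset D <= orbit act o}.
  by move=> x /DP[u _ <-]; rewrite inE; exists u^-1%g.
have [D' D'P] := fset_thickening (orbit act o) r D lf.
have D'X : {subset D' <= orbit act o} by move=> x /D'P[]; rewrite inE.
exists D, D'; split => //; last first.
- have mU : measurable (U : set (borel G)) by exact: compact_measurable_borel.
  have Ufin : mu U \is a fin_num by exact: haar_fin_num.
  have H0 := stabiliser_gt0 hact hG hmu o.
  have Hfin := stabiliser_fin pact hmu o.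
  have b0 : 0 < fine (mu (stabiliser act o)).
    by rewrite fine_gt0// H0 ltey_eq Hfin.
  have u0 : 0 < fine (mu U) by rewrite fine_gt0// U0 ltey_eq Ufin.
  have le1 : (mu [set x | act x^-1%g o \in D'] <=
      mu (mulset [set x | act x^-1%g o \in B] U))%E.
    apply: le_measure; rewrite ?inE.
    + apply: compact_measurable_borel => //; exact: compact_actV_preimage.
    + by apply: compact_measurable_borel => //; exact: compact_mulset.
    + move=> x /= /D'P[_ [d /DP[u Uu <-] dx]].
      exists (x * u^-1)%g; last by exists u => //; rewrite mulgVK.
      apply/BP; rewrite invgM invgK (actM hact); split.
        by exists (u * x^-1)%g => //; rewrite (actM hact).
      exists o; first by rewrite in_fset1.
      by have := dist_le_act hact u dx; rewrite act1V.
  have le2 : (mu U <= mu [set x | act x^-1%g o \in D])%E.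
    apply: le_measure; rewrite ?inE//.
      apply: compact_measurable_borel => //; exact: compact_actV_preimage.
    by move=> x Ux; apply/DP; exists x.
  move: le1 le2 hU; rewrite !measure_actV_preimage// -(fineK Ufin) -(fineK Hfin).
  rewrite inver gt_eqF// lee_pdivrMr// -!EFinM lee_fin => le1 le2 /(le_trans le1).
  rewrite lee_fin => le3; rewrite -(ler_pM2r b0) (le_trans le3)// -mulrA.
  by rewrite ler_wpM2l// addr_ge0// ltW.
- by move=> x /DX; rewrite inE.
- have [x Ux] : U !=set0.
    by apply/set0P; apply: contraTneq U0 => ->; rewrite measure0 ltxx.
  by apply/fset0Pn; exists (act x^-1%g o); apply/DP; exists x.
Qed.

End RightInvariant.
End OrbitGrowth.

Theorem theorem1p3 (R : realType) (Gam : graph) (G : topologicalGroupType)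
    (mu : {measure set (borel G) -> \bar R}) (act : G -> Gam -> Gam)
    (Gam_connected : connected_graph Gam)
    (Gam_locally_finite : locally_finite Gam)
    (G_hausdorff : hausdorff_space G)
    (G_locally_compact : locally_compact [set: G])
    (mu_haar : left_haar_measure mu)
    (act_graph : graph_action act)
    (act_proper : proper_action act)
    (act_quasitransitive : quasitransitive act) :
  amenable_graph Gam R <-> amenable_group mu /\ unimodular mu.
Proof.
have [v0 _] := Gam_connected.1.
have [r orbit_dense] :=
  quasitransitive_dense act_graph v0 Gam_connected act_quasitransitive.
have balls := quasitransitive_bounded_balls act_graph Gam_locally_finite
  act_quasitransitive.
split=> [am|[am /unimodularP rinv]].
  have fol := amenable_folner v0 Gam_locally_finite balls orbit_dense am.
  have rinv := folner_right_invariant Gam_connected G_hausdorff mu_haar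
    act_graph act_proper fol.
  by split; [exact: folner_amenable_group fol|exact/unimodularP].
apply: (folner_amenable v0 Gam_locally_finite balls orbit_dense).
exact: (amenable_group_folner Gam_locally_finite G_hausdorff mu_haar
  act_graph act_proper rinv v0 am).
Qed.
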